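(* Let $f\in Y^*$, let $u\in X$ be the unique solution of $Bu=f$ in $Y^*$, and assume that there is a constant $c_S>0$ such that \[ c_S \, \| v_H \|_X \leq \sup_{0 \neq q_h \in Y_h} \frac{\langle B v_H , q_h \rangle_H}{\| q_h \|_Y} \qquad \text{for all } v_H \in X_H . \] Let $(\widetilde{u}_H,p_h) \in X_H \times Y_h$ be the unique solution of \[ \langle A p_h , q_h \rangle_H + \langle B \widetilde{u}_H , q_h \rangle_H = \langle f , q_h \rangle_H, \qquad \langle p_h , B v_H \rangle_H = 0 \qquad \text{for all } (v_H,q_h) \in X_H \times Y_h . \] Then \[ \| p_h \|_Y \leq \| u - \widetilde{u}_H \|_S \leq c_2^B \, \| u - \widetilde{u}_H \|_X . \]
   Context: All spaces are real. $X \subset H \subset X^*$ and $Y \subset H \subset Y^*$ are Gelfand triples of Hilbert spaces, where $X^*, Y^*$ are the duals of $X, Y$ with respect to $H$; $\langle \cdot,\cdot\rangle_H$ denotes the duality pairing (both for $Y^*\times Y$ and for $X^*\times X$, written in either order). $A : Y \to Y^*$ is a bounded linear operator that is self-adjoint and elliptic in $Y$, and $Y$ is equipped with the norm $\| q \|_Y := \sqrt{\langle A q, q\rangle_H}$; $Y^*$ carries the dual norm $\| f \|_{Y^*} := \sup_{0\neq q\in Y} \langle f,q\rangle_H / \| q \|_Y$. $B : X \to Y^*$ is a bounded linear operator which is surjective and for which there are positive constants $c_1^B, c_2^B$ such that for all $v\in X$ \[ \| B v \|_{Y^*} \leq c_2^B \| v \|_X, \qquad \sup_{0\neq q \in Y}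 \frac{\langle Bv,q\rangle_H}{\| q\|_Y} \geq c_1^B \| v\|_X ; \] thus $B$ is an isomorphism. $B^* : Y \to X^*$ is the adjoint, $\langle B^* q, v\rangle_H := \langle q, Bv\rangle_H$ for all $v\in X$, $q\in Y$. With $S := B^*A^{-1}B : X\to X^*$, the norm $\|\cdot\|_S$ on $X$ is $\| v\|_S := \sqrt{\langle Sv,v\rangle_H} = \| Bv\|_{Y^*}$. $X_H \subset X$ and $Y_h\subset Y$ are finite-dimensional subspaces (finite element spaces). *)

(* Defs.v *)
From HB Require Import structures.
From mathcomp Require Import all_boot all_order all_algebra.
From mathcomp Require Import all_classical all_reals all_analysis.

Set Implicit Arguments.
Unset Strict Implicit.
Unset Printing Implicit Defensive.

Import Order.TTheory GRing.Theory Num.Theory.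
Import numFieldNormedType.Exports.

Local Open Scope classical_set_scope.
Local Open Scope ring_scope.

HB.mixin Record CompleteNormedModule_isHilbert (R : realType) V
    of CompleteNormedModule R V := {
  inner_subdef : {dot V for idfun} ;
  norm_inner_subdef : forall v : V, `|v| = Num.sqrt (inner_subdef v v)
}.

#[short(type="hilbertType")]
HB.structure Definition Hilbert (R : realType) :=
  {V of CompleteNormedModule_isHilbert R V & CompleteNormedModule R V}.

Definition inner {R : realType} {V : hilbertType R} : {dot V for idfun} :=
  inner_subdef.

Lemma norm_innerE (R : realType) (V : hilbertType R) (v : V) :
  `|v| = Num.sqrt (inner v v).
Proof. exact: norm_inner_subdef. Qed.

Section Dual.
Variables (R : realType) (V : normedModType R).

Definition dual_pred : {pred V -> R^o} :=
  [pred f : V -> R^o | `[< scalar f /\ continuous f >]].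

Lemma dual_predP (f : V -> R^o) :
  reflect (scalar f /\ continuous f) (f \in dual_pred).
Proof. exact: asboolP. Qed.

Fact dual_pred_submod : submod_closed dual_pred.
Proof.
split=> [|a f g /dual_predP[lf cf] /dual_predP[lg cg]]; apply/dual_predP; split.
- by move=> a u v; rewrite /= mulr0 addr0.
- by move=> x; exact: cvg_cst.
- move=> b u v; have E w : (a *: f + g) w = a * f w + g w by [].
  by rewrite !E lf lg !mulrDr mulrCA addrACA.
- by move=> x; apply: cvgD; [apply: cvgZr; exact: cf | exact: cg].
Qed.

HB.instance Definition _ :=
  GRing.isSubmodClosed.Build R (V -> R^o) dual_pred dual_pred_submod.

(* The topological dual V^* *)
Record dual := Dual { dual_fun :> V -> R^o ; _ : dual_fun \in dual_pred }.

HB.instance Definition _ := [isSub for dual_fun].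
HB.instance Definition _ := [Choice of dual by <:].
HB.instance Definition _ := [SubChoice_isSubLmodule of dual by <:].

End Dual.

Section DualTheory.
Variables (R : realType) (V : normedModType R).
Implicit Types (f : dual V) (N : V -> R) (D : set V).

Lemma dual_scalar f : scalar f.
Proof. by case: f => f /= /dual_predP[]. Qed.

Lemma dual_continuous f : continuous f.
Proof. by case: f => f /= /dual_predP[]. Qed.

Definition mk_dual (g : V -> R^o) (lg : scalar g) (cg : continuous g) : dual V :=
  Dual (introT (dual_predP g) (conj lg cg)).

(* sup_{0 != q in D} <f, q> / N q, with value 0 when D contains no nonzero
   vector ([sup set0 = 0]). *)
Definition dual_sup N D f : R :=
  sup [set f q / N q | q in [set q | D q /\ q != 0]].

Definition dual_norm N f : R := dual_sup N setT f.

Lemma dual_norm_ub f q : f q <= dual_norm Num.norm f * `|q|.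
Proof.
pose g : {linear V -> R^o} :=
  HB.pack (dual_fun f) (GRing.isLinear.Build _ _ _ _ _ (dual_scalar f)).
have /linear_bounded_continuous/linear_boundedP : continuous g.
  exact: dual_continuous.
move=> /pinfty_ex_gt0[M M0 gM].
have [->|q0] := eqVneq q 0.
  by rewrite normr0 mulr0 -[dual_fun f]/(g : _ -> _) linear0.
rewrite -ler_pdivrMr ?normr_gt0//; apply: ub_le_sup; last by exists q.
exists M => _ [w [_ w0] <-]; rewrite ler_pdivrMr ?normr_gt0//.
exact: le_trans (ler_norm _) (gM w).
Qed.

Lemma dual_norm_abs f q : `|f q| <= dual_norm Num.norm f * `|q|.
Proof.
have fN : f (- q) = - f q.
  by have := dual_scalar f (-1) q 0; rewrite addr0 scaleN1r mulN1r;
     have := dual_scalar f (-1) 0 0; rewrite scaler0 addr0 mulN1r addNr => -> ->;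
     rewrite addr0.
by rewrite ler_norml dual_norm_ub lerNl -fN -[`|q|]normrN dual_norm_ub.
Qed.

End DualTheory.

(* Bounded linear operators V -> W^*; W^* carries the dual norm of W. *)
Record bounded_op (R : realType) (V W : normedModType R) := BoundedOp {
  op_fun :> {linear V -> dual W} ;
  op_bounded : exists M, forall v, dual_norm Num.norm (op_fun v) <= M * `|v|
}.

Section Adjoint.
Variables (R : realType) (V W : normedModType R) (T : bounded_op V W).

Fact adjoint_scalar (q : W) : scalar (fun v => T v q : R^o).
Proof. by move=> a u v; rewrite linearP. Qed.

Fact adjoint_continuous (q : W) : continuous (fun v => T v q : R^o).
Proof.
pose g : {linear V -> R^o} :=
  HB.pack (fun v => T v q : R^o)
    (GRing.isLinear.Build _ _ _ _ _ (adjoint_scalar q)).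
apply: (@bounded_linear_continuous _ _ _ g); have [M TM] := op_bounded T.
apply/linear_boundedP; near=> r => v.
apply: le_trans (dual_norm_abs (T v) q) _.
apply: (@le_trans _ _ (M * `|v| * `|q|)); first exact: ler_wpM2r.
rewrite mulrAC ler_wpM2r//; near: r; apply: nbhs_pinfty_ge.
Unshelve. all: by end_near. Qed.

(* T^* : W -> V^*, <T^* q, v> := <T v, q> *)
Definition adjoint (q : W) : dual V :=
  mk_dual (@adjoint_scalar q) (@adjoint_continuous q).

End Adjoint.

(* A Gelfand triple V c H c V^*: the embedding of V into the pivot space H. *)
Record gelfand (R : realType) (V H : hilbertType R) := Gelfand {
  emb :> {linear V -> H} ;
  emb_inj : injective emb ;
  emb_continuous : continuous emb ;
  emb_dense : dense (range emb)
}.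

Section Inner.
Variables (R : realType) (H : hilbertType R).
Implicit Types x y : H.

Lemma innerC x y : inner x y = inner y x.
Proof. by rewrite hermC expr0 mul1r. Qed.

Lemma norm_inner_sqr x : `|x| ^+ 2 = inner x x.
Proof.
rewrite norm_innerE sqr_sqrtr//.
by have [->|/neq0_dnorm_gt0/ltW//] := eqVneq x 0; rewrite linear0r.
Qed.

Lemma inner_le x y : inner x y <= `|x| * `|y|.
Proof.
have : `|x + y| ^+ 2 <= (`|x| + `|y|) ^+ 2.
  by rewrite ler_sqr ?nnegrE ?addr_ge0// ler_normD.
rewrite sqrrD !norm_inner_sqr hnormD expr0 mul1r /= addrAC lerD2r lerD2l.
by rewrite -mulr2n ler_pMn2r.
Qed.

Lemma inner_abs x y : `|inner x y| <= `|x| * `|y|.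
Proof. by rewrite ler_norml inner_le lerNl -linearNr -[`|y|]normrN inner_le. Qed.

End Inner.

Section Pivot.
Variables (R : realType) (V H : hilbertType R) (j : gelfand V H).

Fact pivot_scalar (h : H) : scalar (fun v => inner h (j v) : R^o).
Proof. by move=> a u v; rewrite !linearP. Qed.

Fact pivot_continuous (h : H) : continuous (fun v => inner h (j v) : R^o).
Proof.
pose g : {linear H -> R^o} := inner h.
have cg : continuous g.
  apply: bounded_linear_continuous; apply/linear_boundedP.
  near=> r => x; apply: le_trans (inner_abs h x) _.
  by rewrite ler_wpM2r//; near: r; exact: nbhs_pinfty_ge.
by move=> v; apply: continuous_comp; [exact: emb_continuous | exact: cg].
Unshelve. all: by end_near. Qed.

(* The inclusion H c V^*, through which the duality pairing [f v] of f : V^*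
   and v : V extends the inner product of H. *)
Definition pivot (h : H) : dual V :=
  mk_dual (@pivot_scalar h) (@pivot_continuous h).
Lemma pivot_inj : injective pivot.
Proof.
move=> h h' hh'; apply/eqP; rewrite -subr_eq0; apply/negPn/negP => d0.
have dj v : inner (h - h') (j v) = 0.
  rewrite linearBl; have := congr1 (fun f : dual V => f v) hh' => /= ->.
  exact: subrr.
move: (h - h') d0 dj => d d0 dj.
have [||z [bz [v _ jv]]] := @emb_dense _ _ _ j (ball d `|d|).
- by exists d; apply: ballxx; rewrite normr_gt0.
- by apply: ball_open; rewrite normr_gt0.
move: bz; rewrite -jv -ball_normE /= ltNge => /negP; apply.
rewrite -(ler_pM2l (_ : 0 < `|d|)) ?normr_gt0// -expr2 norm_inner_sqr.
apply: le_trans (inner_le d (d - j v)).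
by rewrite linearBr /= dj subr0.
Qed.

End Pivot.

Section Energy.
Variables (R : realType) (Y : hilbertType R) (A : bounded_op Y Y).

Definition self_adjoint := adjoint A = A :> (Y -> dual Y).

Definition elliptic :=
  exists2 alpha : R, 0 < alpha & forall q, alpha * `|q| ^+ 2 <= A q q.

Definition energy_norm (q : Y) : R := Num.sqrt (A q q).

(* A^{-1}: by Lax-Milgram the equation A q = f has exactly one solution when A
   is elliptic; without a solution the value is 0. *)
Definition op_inv (f : dual Y) : Y := xget 0 [set q | A q = f].

(* S = B^* A^{-1} B *)
Definition schur (X : hilbertType R) (B : bounded_op X Y) (v : X) : dual X :=
  adjoint B (op_inv (B v)).

Definition schur_norm (X : hilbertType R) (B : bounded_op X Y) (v : X) : R :=
  Num.sqrt (schur B v v).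

End Energy.

Definition finite_dim_subspace (R : realType) (V : lmodType R) (D : set V) :=
  exists n (e : 'I_n -> V),
    D = [set \sum_(i < n) c i *: e i | c in [set: 'I_n -> R]].

(* Main.v *)
(* Let [r] be the energy Riesz representative of the residual: A r = B (u - uH).
   Then [schur_norm (u - uH)] is the energy norm of [r], which is also the dual
   norm of B (u - uH). Since [ph] is the Galerkin solution of
   A ph = B (u - uH) on [Yh], testing with [ph] gives
   A ph ph = A r ph <= (A r r + A ph ph) / 2. *)

Require Import Defs.
From mathcomp Require Import all_boot all_order all_algebra ring lra.
From mathcomp Require Import all_classical all_reals all_analysis.

Import Order.TTheory GRing.Theory Num.Theory.
Import numFieldNormedType.Exports.

Local Open Scope classical_set_scope.
Local Open Scope ring_scope.

Set Implicit Arguments.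
Unset Strict Implicit.
Unset Printing Implicit Defensive.

Section DualLinear.
Variables (R : realType) (V : normedModType R) (g : dual V).

Lemma dualZ a v : g (a *: v) = a * g v.
Proof.
have g0 : g 0 = 0.
  by have := dual_scalar g (-1) 0 0; rewrite scaler0 addr0 mulN1r addNr.
by have := dual_scalar g a v 0; rewrite g0 !addr0.
Qed.

Lemma dualD v w : g (v + w) = g v + g w.
Proof. by have := dual_scalar g 1 v w; rewrite scale1r mul1r. Qed.

End DualLinear.

(** If [d] were nonzero, the linear term would dominate for small [t] of the opposite sign and make
    the value negative. *)
Lemma ge0_quadratic_eq0 (R : realType) (c d : R) :
  (forall t, 0 <= t ^+ 2 * c + t * d) -> d = 0.
Proof.
move=> tcd; apply/eqP/negPn/negP => d0.
have c0 : 0 <= c by have := tcd 1; have := tcd (-1); nra.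
(* The [+ 1] keeps the denominator positive even when [c = 0]. *)
have := tcd (- d / (c + 1)).
have -> : (- d / (c + 1)) ^+ 2 * c + - d / (c + 1) * d =
    - (d / (c + 1)) ^+ 2 by field; lra.
rewrite oppr_ge0 real_exprn_even_le0 ?num_real//= mulf_eq0 invr_eq0 (negbTE d0).
lra.
Qed.

Section SelfAdjointElliptic.
Variables (R : realType) (Y : hilbertType R) (A : bounded_op Y Y).
Hypotheses (A_self_adjoint : self_adjoint A) (A_elliptic : elliptic A).

Lemma op_sym p q : A p q = A q p.
Proof. by rewrite -[in LHS]A_self_adjoint. Qed.

Lemma op_ge0 q : 0 <= A q q.
Proof.
have [a a0 aA] := A_elliptic.
by apply: le_trans (aA q); rewrite mulr_ge0// ?ltW// sqr_ge0.
Qed.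

Lemma energy_norm_sqr q : energy_norm A q ^+ 2 = A q q.
Proof. by rewrite sqr_sqrtr ?op_ge0. Qed.

Lemma energy_norm_gt0 q : q != 0 -> 0 < energy_norm A q.
Proof.
move=> q0; rewrite sqrtr_gt0; have [a a0 aA] := A_elliptic.
by apply: lt_le_trans (aA q); rewrite mulr_gt0// exprn_gt0// normr_gt0.
Qed.

Lemma op_lincomb a b p q :
  A (a *: p + b *: q) (a *: p + b *: q) =
  a ^+ 2 * A p p + 2 * a * b * A p q + b ^+ 2 * A q q.
Proof.
have E r : A (a *: p + b *: q) r = a * A p r + b * A q r.
  by rewrite op_sym dualD !dualZ ![A r _]op_sym.
by rewrite E !dualD !dualZ (op_sym q p); ring.
Qed.

Section Minimization.
Variable g : dual Y.

(** The energy functional whose minimizers are the solutions of [A q = g]. *)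
Let J q : R := A q q - 2 * g q.

Let J_line q w t :
  J (q + t *: w) = J q + (t ^+ 2 * A w w + t * (2 * (A q w - g w))).
Proof.
rewrite /J; have := op_lincomb 1 t q w; rewrite scale1r => ->.
by rewrite dualD dualZ; ring.
Qed.

(** The linear part of [J] cancels. As the midpoint value is at least the infimum, two
    near-minimizers must be close. *)
Let J_parallelogram p q :
  A (p - q) (p - q) = 2 * (J p + J q - 2 * J (2^-1 *: p + 2^-1 *: q)).
Proof.
rewrite /J; have := op_lincomb 1 (-1) p q; rewrite scale1r scaleN1r => ->.
by rewrite op_lincomb dualD !dualZ; field.
Qed.

Let J_has_inf : has_inf (range J).
Proof.
split; first by exists (J 0), 0.
have [a a0 aA] := A_elliptic.
pose M := dual_norm Num.norm g.
exists (- (M ^+ 2 / a)) => _ [q _ <-].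
have gq : g q <= M * `|q| := dual_norm_ub g q.
(* Completing the square in the norm of [q] produces the lower bound. *)
have : 0 <= a * (`|q| - M / a) ^+ 2 by rewrite mulr_ge0 ?sqr_ge0// ltW.
have -> : a * (`|q| - M / a) ^+ 2 = a * `|q| ^+ 2 - 2 * (M * `|q|) + M ^+ 2 / a.
  by field; rewrite gt_eqF.
by have := aA q; rewrite /J; lra.
Qed.

Let m := inf (range J).

Let J_ge q : m <= J q.
Proof. by apply: ge_inf; [exact: J_has_inf.2 | exists q]. Qed.

(* A minimizing sequence of [q |-> A q q - 2 g q] is Cauchy by the
   parallelogram identity, and its limit is a critical point. *)
Lemma op_surjective : exists q, A q = g.
Proof.
have [a a0 aA] := A_elliptic.
have /choice[s Js] n : exists q, J q < m + harmonic n.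
  have [_ [q _ <-] Jq] : exists2 x, range J x & x < m + harmonic n.
    by apply: inf_adherent; [rewrite /harmonic invr_gt0 ltr0n | exact: J_has_inf].
  by exists q.
have inv_cvg0 := @cvg_harmonic R.
have s_cvg : cvg (s @ \oo).
  apply/cauchy_cvgP/cauchy_exP => e e0.
  (* The parallelogram identity bounds [A] at [s N - s n] by [2 * (harmonic N + harmonic n)], which
     must stay below [a * e ^+ 2]. *)
  have d0 : 0 < a * e ^+ 2 / 4 by rewrite divr_gt0// mulr_gt0// exprn_gt0.
  have [N _ HN] := (@cvgr_lt _ _ _ _ _ _ inv_cvg0 _ d0).
  exists (s N); exists N => // n /= Nn.
  rewrite -ball_normE /= -(ltr_pXn2r (_ : 0 < 2)%N) ?nnegrE ?normr_ge0 ?(ltW e0)//.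
  rewrite -(ltr_pM2l a0); apply: le_lt_trans (aA _) _.
  rewrite J_parallelogram.
  have := HN _ (leqnn N); have := HN _ Nn.
  have := Js n; have := Js N; have := J_ge (2^-1 *: s N + 2^-1 *: s n).
  lra.
exists (lim (s @ \oo)); apply/val_inj/funext => w /=.
apply/eqP; rewrite -subr_eq0; apply/eqP.
suff : 2 * (A (lim (s @ \oo)) w - g w) = 0 by lra.
apply: (@ge0_quadratic_eq0 _ (A w w)) => t.
have Aw_cvg : (fun n => A (s n) w) @ \oo --> A (lim (s @ \oo)) w.
  apply: (@cvg_comp _ _ _ s (fun q => A q w : R^o) _ _ _ s_cvg).
  exact: adjoint_continuous.
(* This is [J (s n + t *: w) - J (s n) + harmonic n], nonnegative because
   [J (s n) < m + harmonic n]. *)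
pose h n := t ^+ 2 * A w w + t * (2 * (A (s n) w - g w)) + harmonic n.
have h_cvg : h @ \oo -->
    t ^+ 2 * A w w + t * (2 * (A (lim (s @ \oo)) w - g w)) + 0.
  apply: cvgD inv_cvg0; apply: cvgD; first exact: cvg_cst.
  apply: cvgM; first exact: cvg_cst.
  apply: cvgM; first exact: cvg_cst.
  by apply: cvgB => //; exact: cvg_cst.
rewrite -[leRHS]addr0 -(cvg_lim _ h_cvg)//.
apply: limr_ge; [exact: cvgP h_cvg | apply: nearW => n].
by have := J_ge (s n + t *: w); rewrite J_line /h; have := Js n; lra.
Qed.

End Minimization.

Lemma op_invK g : A (op_inv A g) = g.
Proof. exact: (xgetPex 0 (op_surjective g)). Qed.

(** With [r := op_inv A (B v)], the adjoint turns [schur A B v v] into [B v r], which is [A r r]. *)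
Lemma schur_normE (X : hilbertType R) (B : bounded_op X Y) v :
  schur_norm A B v = energy_norm A (op_inv A (B v)).
Proof. by rewrite /schur_norm /energy_norm op_invK. Qed.

Lemma op_young p q : 2 * A p q <= A p p + A q q.
Proof. by have := op_ge0 (1 *: p + -1 *: q); rewrite op_lincomb; lra. Qed.

(** For nonzero [q], the quotient at [q] itself equals its energy norm. *)
Lemma energy_norm_le_dual_norm q :
  energy_norm A q <= dual_norm (energy_norm A) (A q).
Proof.
have A_bounded :
    has_ubound [set A q r / energy_norm A r | r in [set r | setT r /\ r != 0]].
  (* This bound is Young's inequality for [q] and [r] scaled to unit energy norm. *)
  exists ((A q q + 1) / 2) => _ [r [_ /energy_norm_gt0 r0] <-].
  have := op_young q ((energy_norm A r)^-1 *: r).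
  have -> : A ((energy_norm A r)^-1 *: r) ((energy_norm A r)^-1 *: r) = 1.
    rewrite dualZ op_sym dualZ -energy_norm_sqr.
    by field; rewrite gt_eqF.
  by rewrite dualZ; lra.
have [q0|q0] := eqVneq q 0.
  have Aq0 r : A q r = 0 by rewrite q0 op_sym -(scale0r (0 : Y)) dualZ mul0r.
  rewrite {1}/energy_norm Aq0 sqrtr0.
  (* If [Y] is trivial, the supremum runs over the empty set and takes the default value [0]. *)
  have [[r r0]|no_r] := pselect (exists r : Y, r != 0).
    by apply: ub_le_sup => //; exists r; rewrite // Aq0 mul0r.
  rewrite /dual_norm /dual_sup.
  have -> : [set r : Y | setT r /\ r != 0] = set0.
    by apply/seteqP; split=> // r [_ r0]; apply: no_r; exists r.
  by rewrite image_set0 sup0.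
apply: ub_le_sup => //; exists q => //.
by rewrite -energy_norm_sqr expr2 mulfK// gt_eqF// energy_norm_gt0.
Qed.

End SelfAdjointElliptic.

Unset Implicit Arguments.
Set Strict Implicit.
Set Printing Implicit Defensive.

Theorem lemma2p5 (R : realType) (X Y H : hilbertType R)
  (jX : gelfand X H) (jY : gelfand Y H)
  (A : bounded_op Y Y) (A_self_adjoint : self_adjoint A) (A_elliptic : elliptic A)
  (B : bounded_op X Y) (B_surjective : forall g : dual Y, exists v, B v = g)
  (c1B c2B : R) (c1B_gt0 : 0 < c1B) (c2B_gt0 : 0 < c2B)
  (B_le : forall v, dual_norm (energy_norm A) (B v) <= c2B * `|v|)
  (B_ge : forall v, c1B * `|v| <= dual_sup (energy_norm A) setT (B v))
  (XH : set X) (Yh : set Y)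
  (XH_fin : finite_dim_subspace XH) (Yh_fin : finite_dim_subspace Yh)
  (f : dual Y) (u : X) (Bu : B u = f)
  (cS : R) (cS_gt0 : 0 < cS)
  (infsup : forall vH, XH vH ->
    cS * `|vH| <= dual_sup (energy_norm A) Yh (B vH))
  (uH : X) (ph : Y) (uH_in : XH uH) (ph_in : Yh ph)
  (eq1 : forall qh, Yh qh -> A ph qh + B uH qh = f qh)
  (eq2 : forall vH, XH vH -> B vH ph = 0) :
  energy_norm A ph <= schur_norm A B (u - uH) <= c2B * `|u - uH|.
Proof.
have r_ph : A ph ph = A (op_inv A (B (u - uH))) ph.
  rewrite op_invK// linearB Bu; change (A ph ph = f ph - B uH ph).
  by rewrite -eq1// addrK.
rewrite schur_normE//; apply/andP; split.
  (* By [r_ph] the cross term of Young's inequality is [2 * A ph ph], half of which cancels against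
     the right side. *)
  apply: ler_wsqrtr; have := op_young A_self_adjoint A_elliptic
    (op_inv A (B (u - uH))) ph.
  by rewrite -r_ph; lra.
apply: le_trans (B_le _).
by rewrite -[in leRHS](op_invK A_self_adjoint A_elliptic (B _))
  energy_norm_le_dual_norm.
Qed.
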